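(* Let $d_1, d_2, I_1, I_2$ be positive integers. In Game 3, Player A and Player B start with $I_1$ and $I_2$ M\&M's, respectively. In each round, each player tosses two fair coins (all tosses being independent). If the player's first coin lands heads, that player eats $d_1$ M\&M's, and if the player's second coin lands heads, that player eats $d_2$ M\&M's (so she eats $d_1+d_2$ if both land heads, and none if both land tails). Let $\mathbb{P}_{(d_1,d_2)}^{(3)}(I_1,I_2)$ denote the probability that Game 3 ends in a tie. Then $$\mathbb{P}_{(d_1, d_2)}^{(3)}(I_1, I_2) = \frac{1}{15}\sum_{(D_1, D_2) \in \mathcal{D}}\ \sum_{\substack{r, s, t \geq 0 \\ 1 \leq I_1 - d_1(r + t) - d_2(s + t) \leq D_1}}\ \sum_{\substack{i, j, k \geq 0 \\ 1 \leq I_2 - d_1(i + k) - d_2(j + k) \leq D_2}} \binom{r + s + t}{r,s,t} \binom{i + j + k}{i, j, k}\, D\left(r + s + t,\, i + j + k,\, \frac{1}{15}\right),$$ where $\mathcal{D} = [d_1, d_2, d_1 + d_2] \times [d_1, d_2, d_1 + d_2]$ (a product of multisets, summed over with multiplicity) and $r,s,t,i,j,k$ range over nonnegative integers.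
   Context: The game is played in rounds until, at the end of some round, at least one player has no M\&M's remaining. The game ends in a tie if both players run out of M\&M's in the same round; if exactly one player has M\&M's remaining, that player wins. If a player is ever supposed to eat more M\&M's than she has left, she eats all her remaining M\&M's. Square brackets $[\ ]$ denote multisets (repeated elements are allowed and counted with multiplicity). Thus $\mathcal{D}$ always has exactly nine elements counted with multiplicity. For integers $m,n\ge 0$ and a real number $u$, the (weighted) Delannoy number is $$D(m,n,u)=\sum_{\ell=0}^{\min(m,n)} \binom{m+n-\ell}{m-\ell,\;n-\ell,\;\ell}\, u^{\,m+n-\ell},$$ where $\binom{a+b+c}{a,b,c}=\frac{(a+b+c)!}{a!\,b!\,c!}$ is the multinomial coefficient. *)

(* Defs.v *)
From HB Require Import structures.
From mathcomp Require Import all_boot all_order all_algebra finmap.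
From mathcomp Require Import all_classical all_reals all_analysis.

Set Implicit Arguments.
Unset Strict Implicit.
Unset Printing Implicit Defensive.

Import Order.TTheory GRing.Theory Num.Theory.

Local Open Scope classical_set_scope.
Local Open Scope ring_scope.

Definition mutually_independent (R : realType) (d d' : measure_display)
    (T : measurableType d) (T' : measurableType d') (P : probability T R)
    (I : choiceType) (X : I -> {RV P >-> T'}) : Prop :=
  forall (J : {fset I}) (B : I -> set T'),
    (forall i, i \in J -> measurable (B i)) ->
    P (\bigcap_(i in [set` J]) (X i @^-1` B i)) =
    (\prod_(i <- J) P (X i @^-1` B i))%E.

(* A coin is a Boolean random variable; [true] stands for heads. *)
Definition fair_coin (R : realType) (d : measure_display)
    (T : measurableType d) (P : probability T R) (X : {RV P >-> bool}) : Prop :=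
  P (X @^-1` [set true]) = (2^-1)%:E.

Inductive player := PlayerA | PlayerB.
Inductive coin_id := FirstCoin | SecondCoin.

Definition bool_of_player (p : player) : bool :=
  if p is PlayerA then false else true.
Definition player_of_bool (b : bool) : player :=
  if b then PlayerB else PlayerA.
Lemma bool_of_playerK : cancel bool_of_player player_of_bool.
Proof. by case. Qed.
HB.instance Definition _ := Choice.copy player (can_type bool_of_playerK).

Definition bool_of_coin_id (c : coin_id) : bool :=
  if c is FirstCoin then false else true.
Definition coin_id_of_bool (b : bool) : coin_id :=
  if b then SecondCoin else FirstCoin.
Lemma bool_of_coin_idK : cancel bool_of_coin_id coin_id_of_bool.
Proof. by case. Qed.
HB.instance Definition _ := Choice.copy coin_id (can_type bool_of_coin_idK).

(* The toss [(n, p, c)] is that of player [p]'s coin [c] in round [n], where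
   rounds are numbered from 0. *)
Definition toss : choiceType := (nat * player * coin_id)%type.

(* The number of M&M's that player [p] is supposed to eat in round [n], when
   the outcomes of all the tosses are given by [h]. *)
Definition appetite (d1 d2 : nat) (h : toss -> bool) (n : nat) (p : player)
    : nat :=
  ((if h (n, p, FirstCoin) then d1 else 0) +
   (if h (n, p, SecondCoin) then d2 else 0))%N.

(* The numbers of M&M's held by Players A and B after [n] rounds. The state is
   frozen once the game is over. The truncated subtraction on [nat] accounts
   for a player who is supposed to eat more M&M's than she has left. *)
Fixpoint game_state (d1 d2 I1 I2 : nat) (h : toss -> bool) (n : nat)
    : nat * nat :=
  if n is n'.+1 then
    let: (a, b) := game_state d1 d2 I1 I2 h n' in
    if (a == 0%N) || (b == 0%N) then (a, b)
    else ((a - appetite d1 d2 h n' PlayerA)%N,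
          (b - appetite d1 d2 h n' PlayerB)%N)
  else (I1, I2).

(* For positive [I1] and [I2], since the state is frozen as soon as one player
   runs out, [(0, 0)] is reached only if both run out in the same round. *)
Definition ends_in_tie (d1 d2 I1 I2 : nat) (h : toss -> bool) : Prop :=
  exists n, game_state d1 d2 I1 I2 h n = (0%N, 0%N).

Definition tie_probability (R : realType) (d : measure_display)
    (T : measurableType d) (P : probability T R)
    (coin : toss -> {RV P >-> bool}) (d1 d2 I1 I2 : nat) : \bar R :=
  P [set w | ends_in_tie d1 d2 I1 I2 (fun i => coin i w)].

Definition trinomial (R : realType) (a b c : nat) : R :=
  (a + b + c)`!%:R / (a`! * b`! * c`!)%:R.

Definition delannoy (R : realType) (m n : nat) (u : R) : R :=
  \sum_(l < (minn m n).+1)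
    trinomial R (m - l) (n - l) l * u ^+ (m + n - l).

(* The triples [(r, s, t)] with 1 <= I - d1 (r + t) - d2 (s + t) <= D, where
   the subtraction is that of integers. For positive [d1] and [d2] this set is
   finite, so finitely supported sums over it are genuine sums. *)
Definition step_counts (d1 d2 I D : nat) : set (nat * nat * nat) :=
  [set x | let: (r, s, t) := x in
    (1 <= I%:Z - d1%:Z * (r%:Z + t%:Z) - d2%:Z * (s%:Z + t%:Z) <= D%:Z)%R].

Definition round_amounts (d1 d2 : nat) : seq nat :=
  [:: d1; d2; (d1 + d2)%N].

(* Main.v *)
(** Conditioning on the first round, the tie probability p(a, b) satisfies
    15 p(a, b) = sum of p(a - x, b - y) over the 15 nonzero outcomes (x, y),
    which determines p by induction on a + b. The right-hand side of the formula
    satisfies the same recurrence. To see this, let L_a phi be the sum, over D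
    and over the triples (r, s, t) of the index set for D, of
    trinomial r s t * phi (r + s + t). Splitting off the first of the
    r + s + t moves gives
    L_a phi = #{D | a <= D} * phi 0 + sum_E L_(a - E) (phi o succn),
    and with u = 1/15 the Delannoy recurrence
    D(m+1, n+1) = u (D(m, n+1) + D(m+1, n) + D(m, n)) turns the double sum
    L_a (m |-> L_b (n |-> D(m, n))) into the recurrence for 15 p(a, b). *)
Require Import Defs.
From mathcomp Require Import all_boot all_order all_algebra finmap.
From mathcomp Require Import all_classical all_reals all_analysis.
From mathcomp Require Import zify ring.

Set Implicit Arguments.
Unset Strict Implicit.
Unset Printing Implicit Defensive.

Import Order.TTheory GRing.Theory Num.Theory.
Import numFieldNormedType.Exports.

Local Open Scope classical_set_scope.
Local Open Scope ring_scope.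

(** * Finite sums with a shifted index *)

Lemma sum_ord_shift (V : nmodType) (M : nat) (g : nat -> V) :
  g M = 0 -> \sum_(i < M) g i = g 0%N + \sum_(i < M) g i.+1 .
Proof.
move=> gM; transitivity (\sum_(i < M.+1) g i).
  by rewrite big_ord_recr /= gM addr0.
by rewrite big_ord_recl.
Qed.

(** Extending by zero at index 0, instead of using [n.-1], lets Pascal-type recurrences hold on the
    boundary without case distinctions. *)
Definition at_pred (V : nmodType) (g : nat -> V) (n : nat) : V :=
  if n is n'.+1 then g n' else 0.

Lemma at_pred_eq0 (V : nmodType) (g : nat -> V) (n : nat) :
  g n.-1 = 0 -> at_pred g n = 0.
Proof. by case: n. Qed.

Lemma sum_at_pred (V : nmodType) (M : nat) (g : nat -> V) :
  at_pred g M = 0 -> \sum_(i < M) at_pred g i = \sum_(i < M) g i.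
Proof. by move=> gM; rewrite sum_ord_shift //= add0r. Qed.

(** * Pascal's rule for trinomial coefficients *)

Lemma trinomialCA (R : realType) a b c : trinomial R a b c = trinomial R b a c.
Proof. by rewrite /trinomial (addnC a) [(a`! * _)%N]mulnC. Qed.

Lemma trinomialAC (R : realType) a b c : trinomial R a b c = trinomial R a c b.
Proof. by rewrite /trinomial addnAC mulnAC. Qed.

(** Cancelling factorials gives the ratio [a / (a + b + c)]; for [a = 0] both sides are zero. *)
Lemma trinomial_at_pred (R : realType) (a b c : nat) :
  at_pred (fun a' => trinomial R a' b c) a =
  trinomial R a b c * a%:R / (a + b + c)%:R.
Proof.
case: a => [|a] /=; first by rewrite mulr0 mul0r.
rewrite /trinomial !addSn !factS !natrM.
have fn0 n : n`!%:R != 0 :> R by rewrite pnatr_eq0 -lt0n fact_gt0.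
have Sn0 n : n.+1%:R != 0 :> R by rewrite pnatr_eq0.
by field; rewrite -!natrD !nat1r !fn0 !Sn0.
Qed.

(** The three lowered coefficients are the fractions [a], [b], [c] over [a + b + c] of the original
    one, and these fractions add up to 1. The indicator covers the empty word, where the common
    denominator is zero. *)
Lemma trinomial_rec (R : realType) (a b c : nat) :
  trinomial R a b c =
  (a + b + c == 0)%N%:R + at_pred (fun a' => trinomial R a' b c) a +
  at_pred (fun b' => trinomial R a b' c) b +
  at_pred (fun c' => trinomial R a b c') c.
Proof.
rewrite trinomial_at_pred.
have -> : (fun b' => trinomial R a b' c) = (fun b' => trinomial R b' a c).
  by apply/funext => b'; rewrite trinomialCA.
have -> : (fun c' => trinomial R a b c') = (fun c' => trinomial R c' b a).
  by apply/funext => c'; rewrite trinomialAC trinomialCA trinomialAC.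
rewrite !trinomial_at_pred (trinomialCA _ b a) (trinomialCA _ c b).
rewrite (trinomialAC _ b c a) (trinomialCA _ b a) (addnC b a).
have -> : (c + b + a = a + b + c)%N by lia.
case: (eqVneq (a + b + c)%N 0%N) => [n0|n0].
  have [-> [-> ->]] : a = 0%N /\ b = 0%N /\ c = 0%N by lia.
  by rewrite /trinomial !fact0 mulr0 !mul0r !addr0 divr1.
have nR : (a + b + c)%:R != 0 :> R by rewrite pnatr_eq0.
by rewrite add0r -!mulrDl -!mulrDr -!natrD mulfK.
Qed.

(** * The Delannoy recurrence *)

(** The guard removes the spurious terms that truncated subtraction would create for [l] above [m]
    or [n], so Delannoy numbers with different indices can be summed over one common range. *)
Definition delannoy_term (R : realType) (u : R) (m n l : nat) : R :=
  if (l <= m)%N && (l <= n)%N then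
    trinomial R (m - l) (n - l) l * u ^+ (m + n - l)
  else 0.

Lemma delannoyE (R : realType) (u : R) (m n K : nat) :
  (minn m n < K)%N -> delannoy m n u = \sum_(l < K) delannoy_term u m n l.
Proof.
move=> mnK; rewrite /delannoy.
rewrite (big_ord_widen K (fun l => trinomial R (m - l) (n - l) l * u ^+ (m + n - l))) //.
by rewrite big_mkcond; apply: eq_bigr => l _; rewrite /delannoy_term ltnS leq_min.
Qed.

(** Pascal's rule applied to [(m.+1 - l, n.+1 - l, l)]: lowering the first, second or third count
    removes a horizontal, vertical or diagonal step, and each removal costs one factor [u]. *)
Lemma delannoy_term_rec (R : realType) (u : R) (m n l : nat) :
  delannoy_term u m.+1 n.+1 l =
  u * (delannoy_term u m n.+1 l + delannoy_term u m.+1 n l +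
       at_pred (delannoy_term u m n) l).
Proof.
rewrite /delannoy_term; case: ifP => /andP lmn; last first.
  have -> : ((l <= m) && (l <= n.+1))%N = false by apply/negP => /andP; lia.
  have -> : ((l <= m.+1) && (l <= n))%N = false by apply/negP => /andP; lia.
  rewrite !add0r; case: l lmn => [|l] lmn /=; first by rewrite mulr0.
  by case: ifP => [/andP|_]; [lia | rewrite mulr0].
have [lm ln] := lmn.
rewrite trinomial_rec.
have -> : (m.+1 - l + (n.+1 - l) + l == 0)%N = false by lia.
rewrite add0r !mulrDl !mulrDr; congr (_ + _ + _).
(* The guard fails only for [l = m.+1]; the first count is then zero and [at_pred] vanishes as
   well. *)
- case: leqP => lm' /=; last first.
    have -> : (m.+1 - l = 0)%N by lia.
    by rewrite /= mul0r mulr0.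
  rewrite ln (subSn lm') /= mulrCA -exprS; congr (_ * u ^+ _); lia.
- rewrite lm; case: leqP => ln' /=; last first.
    have -> : (n.+1 - l = 0)%N by lia.
    by rewrite /= mul0r mulr0.
  rewrite (subSn ln') /= mulrCA -exprS; congr (_ * u ^+ _); lia.
- case: l lm ln {lmn} => [|l] lm ln /=; first by rewrite mul0r mulr0.
  rewrite !ltnS in lm ln; rewrite addSn !subSS lm ln /= mulrCA -exprS; congr (_ * u ^+ _); lia.
Qed.

Lemma delannoy_rec (R : realType) (u : R) (m n : nat) :
  delannoy m.+1 n.+1 u =
  u * (delannoy m n.+1 u + delannoy m.+1 n u + delannoy m n u).
Proof.
rewrite !(@delannoyE _ _ _ _ (m + n + 3)); try lia.
under eq_bigr do rewrite delannoy_term_rec.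
rewrite -mulr_sumr !big_split /=.
(* The last shifted term has index [m + n + 2], beyond both [m] and [n], so its guard fails. *)
rewrite sum_at_pred // addn3 /= /delannoy_term.
by case: ifP => // /andP; lia.
Qed.

Lemma delannoy0n (R : realType) (u : R) (n : nat) : delannoy 0 n u = u ^+ n.
Proof.
rewrite /delannoy min0n big_ord1 /= !subn0 /trinomial fact0 !addn0 muln1 mul1n.
by rewrite divff ?mul1r // pnatr_eq0 -lt0n fact_gt0.
Qed.

Lemma delannoyn0 (R : realType) (u : R) (n : nat) : delannoy n 0 u = u ^+ n.
Proof.
rewrite /delannoy minn0 big_ord1 /= !subn0 /trinomial fact0 !addn0 !muln1.
by rewrite divff ?mul1r // pnatr_eq0 -lt0n fact_gt0.
Qed.

(** * The index sets over the natural numbers *)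

Definition in_step (d1 d2 a D : nat) (r s t : nat) : bool :=
  (d1 * (r + t) + d2 * (s + t) < a <= d1 * (r + t) + d2 * (s + t) + D)%N.

Lemma step_countsE (d1 d2 a D r s t : nat) :
  step_counts d1 d2 a D (r, s, t) <-> in_step d1 d2 a D r s t.
Proof.
rewrite /step_counts /in_step /=.
have -> : d1%:Z * (r%:Z + t%:Z) = (d1 * (r + t))%N%:Z by lia.
have -> : d2%:Z * (s%:Z + t%:Z) = (d2 * (s + t))%N%:Z by lia.
by split; lia.
Qed.

Lemma in_step0 (d1 d2 a D : nat) : in_step d1 d2 a D 0 0 0 = (0 < a <= D)%N.
Proof. by rewrite /in_step !muln0 !add0n. Qed.

(** Truncation in [a - d1] is harmless: if [a <= d1], the strict lower bound fails on both sides. *)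
Lemma in_stepSr (d1 d2 a D r s t : nat) :
  in_step d1 d2 a D r.+1 s t = in_step d1 d2 (a - d1) D r s t.
Proof. rewrite /in_step addSn mulnS; lia. Qed.

Lemma in_stepSs (d1 d2 a D r s t : nat) :
  in_step d1 d2 a D r s.+1 t = in_step d1 d2 (a - d2) D r s t.
Proof. rewrite /in_step addSn mulnS; lia. Qed.

Lemma in_stepSt (d1 d2 a D r s t : nat) :
  in_step d1 d2 a D r s t.+1 = in_step d1 d2 (a - (d1 + d2)) D r s t.
Proof. rewrite /in_step !addnS !mulnS; lia. Qed.

Lemma in_step_lt (d1 d2 a D r s t : nat) : (0 < d1)%N -> (0 < d2)%N ->
  in_step d1 d2 a D r s t -> [/\ (r < a)%N, (s < a)%N & (t < a)%N].
Proof. by rewrite /in_step => d1_gt0 d2_gt0 /andP[+ _]; split; nia. Qed.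

(** * The right-hand side and its recurrence *)

Section Walks.
Variables (R : realType) (d1 d2 M : nat).
Hypotheses (d1_gt0 : (0 < d1)%N) (d2_gt0 : (0 < d2)%N).

(* The bound [M] on the three counts is harmless as soon as [a <= M], see
   [step_counts_fsbig]; keeping it independent of [a] lets [a] decrease. *)
Definition last_walks (D a : nat) (phi : nat -> R) : R :=
  \sum_(r < M) \sum_(s < M) \sum_(t < M)
    (in_step d1 d2 a D r s t)%:R * (trinomial R r s t * phi (r + s + t)%N).

(** [trinomial_rec] sorts the words of moves by one distinguished move. Removing it lowers [a] by
    the amount eaten and shifts the argument of [phi]; the empty word gives the isolated term. *)
Lemma last_walks_rec (D a : nat) (phi : nat -> R) : (a < M)%N ->
  last_walks D a phi = (0 < a <= D)%N%:R * phi 0%N +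
    \sum_(E <- round_amounts d1 d2) last_walks D (a - E) (phi \o succn).
Proof.
move=> aM; rewrite /last_walks.
have M0 : (0 < M)%N by lia.
pose K r s t : R := (in_step d1 d2 a D r s t)%:R.
have K0 r s t : (M <= r)%N || (M <= s)%N || (M <= t)%N -> K r s t = 0.
  rewrite /K; case: (boolP (in_step _ _ _ _ _ _ _)) => // /(in_step_lt d1_gt0 d2_gt0).
  by case; lia.
pose P0 r s t : R := K r s t * ((r + s + t == 0)%N%:R * phi (r + s + t)%N).
pose P1 r s t : R := at_pred (fun r' => K r'.+1 s t * (trinomial R r' s t * phi (r' + s + t).+1)) r.
pose P2 r s t : R := at_pred (fun s' => K r s'.+1 t * (trinomial R r s' t * phi (r + s' + t).+1)) s.
pose P3 r s t : R := at_pred (fun t' => K r s t'.+1 * (trinomial R r s t' * phi (r + s + t').+1)) t.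
transitivity (\sum_(r < M) \sum_(s < M) \sum_(t < M) (P0 r s t + P1 r s t + P2 r s t + P3 r s t)).
  apply: eq_bigr => r _; apply: eq_bigr => s _; apply: eq_bigr => t _.
  rewrite {1}trinomial_rec !mulrDl !mulrDr /P1 /P2 /P3; congr (_ + _ + _ + _).
  - by case: (nat_of_ord r) => [|r'] /=; rewrite ?mul0r ?mulr0.
  - by case: (nat_of_ord s) => [|s'] /=; rewrite ?mul0r ?mulr0 // addnS.
  - by case: (nat_of_ord t) => [|t'] /=; rewrite ?mul0r ?mulr0 // addnS.
(* In each sum the index lowered by [at_pred] is moved innermost, ready for [sum_at_pred]. *)
transitivity (\sum_(r < M) \sum_(s < M) \sum_(t < M) P0 r s t +
  \sum_(s < M) \sum_(t < M) \sum_(r < M) P1 r s t +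
  \sum_(r < M) \sum_(t < M) \sum_(s < M) P2 r s t +
  \sum_(r < M) \sum_(s < M) \sum_(t < M) P3 r s t).
  rewrite [X in _ + X + _ + _](_ : _ = \sum_(r < M) \sum_(s < M) \sum_(t < M) P1 r s t); last first.
    rewrite [RHS]exchange_big; apply: eq_bigr => s _; exact: exchange_big.
  rewrite [X in _ + _ + X + _](_ : _ = \sum_(r < M) \sum_(s < M) \sum_(t < M) P2 r s t); last first.
    apply: eq_bigr => r _; exact: exchange_big.
  rewrite -!big_split; apply: eq_bigr => r _ /=.
  rewrite -!big_split; apply: eq_bigr => s _ /=.
  by rewrite -!big_split.
rewrite !big_cons big_nil addr0 !addrA; congr (_ + _ + _ + _).
- rewrite -(in_step0 d1 d2).
  pose o := Ordinal M0.
  rewrite (bigD1 o) //= (bigD1 o) //= (bigD1 o) //= big1 ?addr0; last first.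
    by case=> [[|i] /= iM] // _; rewrite /P0 /= mul0r mulr0.
  rewrite big1 ?addr0; last first.
    case=> [[|i] /= iM] // _; rewrite big1 // => j _.
    by rewrite /P0 /= mul0r mulr0.
  rewrite big1 ?addr0; last first.
    case=> [[|i] /= iM] // _; rewrite big1 // => j _; rewrite big1 // => k _.
    by rewrite /P0 /= mul0r mulr0.
  by rewrite /P0 /K eqxx mul1r.
- rewrite [RHS]exchange_big; apply: eq_bigr => s _.
  rewrite [RHS]exchange_big; apply: eq_bigr => t _.
  rewrite sum_at_pred; first by apply: eq_bigr => r _; rewrite /K in_stepSr.
  (* The boundary term lost by the shift carries [K] at index [M], where it is zero. *)
  by apply: at_pred_eq0; rewrite K0 ?mul0r // prednK // leqnn.
- apply: eq_bigr => r _; rewrite [RHS]exchange_big; apply: eq_bigr => t _.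
  rewrite sum_at_pred; first by apply: eq_bigr => s _; rewrite /K in_stepSs.
  by apply: at_pred_eq0; rewrite K0 ?mul0r // prednK // leqnn ?orbT.
- apply: eq_bigr => r _; apply: eq_bigr => s _.
  rewrite sum_at_pred; first by apply: eq_bigr => t _; rewrite /K in_stepSt.
  by apply: at_pred_eq0; rewrite K0 ?mul0r // prednK // leqnn ?orbT.
Qed.

(** By [in_step_lt] the index set lies in the cube of side [M]; the indicator makes the rest of the
    cube contribute zero. *)
Lemma step_counts_fsbig (D a : nat) (phi : nat * nat * nat -> R) : (a <= M)%N ->
  \sum_(x \in step_counts d1 d2 a D) phi x =
  \sum_(r < M) \sum_(s < M) \sum_(t < M)
    (in_step d1 d2 a D r s t)%:R * phi ((r : nat), (s : nat), (t : nat)).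
Proof.
move=> aM.
have K0 r s t : (M <= r)%N || (M <= s)%N || (M <= t)%N -> in_step d1 d2 a D r s t = false.
  by apply: contraTF => /(in_step_lt d1_gt0 d2_gt0) []; lia.
pose box := [seq (rs, t) | rs <- [seq (r, s) | r <- index_iota 0 M, s <- index_iota 0 M],
  t <- index_iota 0 M].
have inbox r s t : ((r, s, t) \in box) = (r < M)%N && (s < M)%N && (t < M)%N.
  apply/allpairsP/idP => [[[[r' s'] t'] /= [/allpairsP[[r1 s1] /=]]]|].
    by rewrite !mem_index_iota => -[? ? [-> ->]] ? [-> -> ->]; lia.
  move=> /andP[/andP[? ?] ?]; exists ((r, s), t); split=> //=.
    by apply: allpairs_f; rewrite mem_index_iota.
  by rewrite mem_index_iota.
pose G (x : nat * nat * nat) := (in_step d1 d2 a D x.1.1 x.1.2 x.2)%:R * phi x.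
transitivity (\sum_(x \in step_counts d1 d2 a D) G x).
  apply: eq_fsbigr => -[[r s] t]; rewrite inE => /step_countsE xin.
  by rewrite /G /= xin mul1r.
rewrite (@fsbig_widen _ _ _ _ _ [set` box]).
- rewrite -fsbig_seq; last first.
    apply: allpairs_uniq; [|exact: iota_uniq|by move=> [? ?] [? ?] _ _].
    by apply: allpairs_uniq; [exact: iota_uniq|exact: iota_uniq|move=> [? ?] [? ?] _ _].
  rewrite !big_allpairs big_mkord; apply: eq_bigr => r _.
  rewrite big_mkord; apply: eq_bigr => s _.
  by rewrite big_mkord.
- move=> [[r s] t] /step_countsE xin /=; rewrite inbox.
  by move: xin; apply: contraTT => ?; rewrite K0 //; lia.
- move=> [[r s] t] [_ /= nin]; rewrite /G /=.
  case: (boolP (in_step _ _ _ _ _ _ _)) => [/step_countsE //|_]; exact: mul0r.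
Qed.

Lemma last_walksD (D a : nat) (phi psi : nat -> R) :
  last_walks D a (fun m => phi m + psi m) = last_walks D a phi + last_walks D a psi.
Proof.
rewrite /last_walks -big_split; apply: eq_bigr => r _ /=.
rewrite -big_split; apply: eq_bigr => s _ /=.
by rewrite -big_split; apply: eq_bigr => t _ /=; rewrite !mulrDr.
Qed.

Lemma last_walksZ (D a : nat) (c : R) (phi : nat -> R) :
  last_walks D a (fun m => c * phi m) = c * last_walks D a phi.
Proof.
rewrite /last_walks mulr_sumr; apply: eq_bigr => r _.
rewrite mulr_sumr; apply: eq_bigr => s _.
rewrite mulr_sumr; apply: eq_bigr => t _; ring.
Qed.

Definition walks (a : nat) (phi : nat -> R) : R :=
  \sum_(D <- round_amounts d1 d2) last_walks D a phi.

(** For positive [a], this counts the nonzero outcomes of a round that finish off a player holding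
    [a]. *)
Definition last_round (a : nat) : R :=
  \sum_(D <- round_amounts d1 d2) (0 < a <= D)%N%:R.

Lemma walks_rec (a : nat) (phi : nat -> R) : (a < M)%N ->
  walks a phi = last_round a * phi 0%N +
    \sum_(E <- round_amounts d1 d2) walks (a - E) (phi \o succn).
Proof.
move=> aM; rewrite /walks /last_round mulr_suml [X in _ + X]exchange_big -big_split.
by apply: eq_bigr => D _; rewrite last_walks_rec.
Qed.

Lemma walks0 (phi : nat -> R) : walks 0 phi = 0.
Proof.
rewrite /walks big1 // => D _; rewrite /last_walks.
by do 3 (apply: big1 => ? _); rewrite /in_step ltn0 mul0r.
Qed.

Lemma walksD (a : nat) (phi psi : nat -> R) :
  walks a (fun m => phi m + psi m) = walks a phi + walks a psi.
Proof. by rewrite /walks -big_split; apply: eq_bigr => D _; exact: last_walksD. Qed.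

Lemma walksZ (a : nat) (c : R) (phi : nat -> R) :
  walks a (fun m => c * phi m) = c * walks a phi.
Proof. by rewrite /walks mulr_sumr; apply: eq_bigr => D _; exact: last_walksZ. Qed.

Lemma walks_sum (I : Type) (a : nat) (r : seq I) (phi : I -> nat -> R) :
  walks a (fun m => \sum_(i <- r) phi i m) = \sum_(i <- r) walks a (phi i).
Proof.
elim: r => [|i r IHr].
  transitivity (walks a (fun m => 0 * (fun=> 0) m)); last by rewrite walksZ mul0r big_nil.
  by congr walks; apply/funext => m; rewrite big_nil mul0r.
rewrite big_cons -IHr -walksD.
by congr walks; apply/funext => m; rewrite big_cons.
Qed.

(** This is the ninefold sum of the theorem, factored into one linear operator per player; see
    [tie_walksE]. *)
Definition tie_walks (u : R) (a b : nat) : R :=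
  walks a (fun m => walks b (fun n => delannoy m n u)).

Lemma tie_walks0n (u : R) (b : nat) : tie_walks u 0 b = 0.
Proof. exact: walks0. Qed.

Lemma tie_walksn0 (u : R) (a : nat) : tie_walks u a 0 = 0.
Proof.
transitivity (walks a (fun m => 0 * (fun=> 0) m)); last by rewrite walksZ mul0r.
by congr walks; apply/funext => m; rewrite walks0 mul0r.
Qed.

Lemma tie_walks_rec (u : R) (a b : nat) : (a < M)%N -> (b < M)%N ->
  tie_walks u a b = last_round a * last_round b +
    u * (\sum_(E <- round_amounts d1 d2) tie_walks u (a - E) b +
         \sum_(E <- round_amounts d1 d2) tie_walks u a (b - E) +
         \sum_(E <- round_amounts d1 d2) \sum_(E' <- round_amounts d1 d2)
            tie_walks u (a - E) (b - E')).
Proof.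
move=> aM bM.
(* [W] applies Player B's operator to row [m], and [V] does so after one move of B. [W0] and [WS]
   express the Delannoy recurrence for these rows, with boundary values the powers of [u]. *)
pose W m := walks b (fun n => delannoy m n u).
pose V m := \sum_(E <- round_amounts d1 d2) walks (b - E) (fun n => delannoy m n u).
have W0 : W 0%N = last_round b + u * V 0%N.
  rewrite /W walks_rec // delannoy0n expr0 mulr1 /V mulr_sumr; congr (_ + _).
  apply: eq_bigr => E _; rewrite -walksZ; congr walks; apply/funext => n /=.
  by rewrite !delannoy0n exprS.
have WS m : W m.+1 = u * (W m + V m.+1 + V m).
  rewrite {2}/W /W !walks_rec // !delannoyn0 exprS /V !mulrDr mulrCA -!addrA.
  congr (_ + _); rewrite !mulr_sumr -!big_split; apply: eq_bigr => E _ /=.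
  rewrite -!walksZ -!walksD; congr walks; apply/funext => n /=.
  by rewrite delannoy_rec !mulrDr addrA.
have walksV c : \sum_(E <- round_amounts d1 d2) tie_walks u c (b - E) = walks c V.
  by rewrite walks_sum.
rewrite walksV (eq_bigr _ (fun E _ => walksV (a - E)%N)).
rewrite /tie_walks walks_rec // -/(W 0%N) W0.
have -> : \sum_(E <- round_amounts d1 d2) walks (a - E) ((fun m => walks b (fun n => delannoy m n u)) \o succn) =
  u * (\sum_(E <- round_amounts d1 d2) walks (a - E) W +
  \sum_(E <- round_amounts d1 d2) walks (a - E) (V \o succn) +
  \sum_(E <- round_amounts d1 d2) walks (a - E) V).
  rewrite -!big_split mulr_sumr; apply: eq_bigr => E _ /=.
  rewrite -!walksD -walksZ; congr walks; apply/funext => m /=.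
  exact: WS.
(* Expanding [walks a V] supplies both the term in [V 0] and the sum over [V \o succn]. *)
rewrite (walks_rec V aM); ring.
Qed.

Lemma step_counts_walks (D1 D2 a b : nat) (u : R) : (a <= M)%N -> (b <= M)%N ->
  \sum_(x \in step_counts d1 d2 a D1) \sum_(y \in step_counts d1 d2 b D2)
    (let: (r, s, t) := x in
     let: (i, j, k) := y in
     trinomial R r s t * trinomial R i j k * delannoy (r + s + t) (i + j + k) u) =
  last_walks D1 a (fun m => last_walks D2 b (fun n => delannoy m n u)).
Proof.
move=> aM bM; rewrite step_counts_fsbig //.
apply: eq_bigr => r _; apply: eq_bigr => s _; apply: eq_bigr => t _.
congr (_ * _); rewrite step_counts_fsbig // -last_walksZ.
apply: eq_bigr => i _; apply: eq_bigr => j _; apply: eq_bigr => k _; ring.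
Qed.

Lemma tie_walksE (u : R) (a b : nat) : (a <= M)%N -> (b <= M)%N ->
  \sum_(D <- [seq (D1, D2) | D1 <- round_amounts d1 d2, D2 <- round_amounts d1 d2])
    \sum_(x \in step_counts d1 d2 a D.1) \sum_(y \in step_counts d1 d2 b D.2)
      (let: (r, s, t) := x in
       let: (i, j, k) := y in
       trinomial R r s t * trinomial R i j k * delannoy (r + s + t) (i + j + k) u) =
  tie_walks u a b.
Proof.
move=> aM bM; rewrite big_allpairs; apply: eq_bigr => D1 _ /=.
transitivity (\sum_(D2 <- round_amounts d1 d2)
  last_walks D1 a (fun m => last_walks D2 b (fun n => delannoy m n u))).
  by apply: eq_bigr => D2 _; rewrite -step_counts_walks.
rewrite !big_cons big_nil addr0 -!last_walksD; congr last_walks; apply/funext => m.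
by rewrite /walks !big_cons big_nil addr0.
Qed.
End Walks.

(** * Rounds as letters and the game as a fold *)

Definition outcome : finType := ((bool * bool) * (bool * bool))%type.

Definition outcome_of (h : toss -> bool) (n : nat) : outcome :=
  ((h (n, PlayerA, FirstCoin), h (n, PlayerA, SecondCoin)),
   (h (n, PlayerB, FirstCoin), h (n, PlayerB, SecondCoin))).

Definition toss_value (o : outcome) (p : player) (c : coin_id) : bool :=
  let b := if p is PlayerA then o.1 else o.2 in
  if c is FirstCoin then b.1 else b.2.

Definition eaten (d1 d2 : nat) (b : bool * bool) : nat :=
  ((if b.1 then d1 else 0) + (if b.2 then d2 else 0))%N.

Definition play_round (d1 d2 : nat) (s : nat * nat) (o : outcome) : nat * nat :=
  if (s.1 == 0)%N || (s.2 == 0)%N then s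
  else (s.1 - eaten d1 d2 o.1, s.2 - eaten d1 d2 o.2)%N.

Lemma game_stateE (d1 d2 I1 I2 : nat) (h : toss -> bool) (n : nat) :
  game_state d1 d2 I1 I2 h n =
  foldl (play_round d1 d2) (I1, I2) (mkseq (outcome_of h) n).
Proof.
elim: n => [//|n IHn]; rewrite mkseqS foldl_rcons -IHn /=.
by case: game_state => a b; rewrite /play_round /=.
Qed.

(** * Probabilities of finite toss sequences *)

Section Probability.
Variables (R : realType) (d : measure_display) (T : measurableType d).
Variables (P : probability T R) (coin : toss -> {RV P >-> bool}).
Hypotheses (coin_fair : forall i : toss, fair_coin (coin i)).
Hypotheses (coin_indep : mutually_independent coin).

Let tosses_at (x : T) : toss -> bool := fun i => coin i x.

Definition cylinder (w : seq outcome) : set T :=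
  [set x | mkseq (outcome_of (tosses_at x)) (size w) = w].

Definition tosses_before (n : nat) : {fset toss} :=
  [fset i in [seq (x, c) | x <- [seq (k, p) | k <- iota 0 n, p <- [:: PlayerA; PlayerB]],
                           c <- [:: FirstCoin; SecondCoin]]]%fset.

Lemma mem_tosses_before (n k : nat) (p : player) (c : coin_id) :
  ((k, p, c) \in tosses_before n) = (k < n)%N.
Proof.
rewrite /tosses_before inE; apply/allpairsP/idP.
  by case=> -[x c'] [/allpairsP[[k' p'] [+ _ ->]] _ [-> _ _]]; rewrite mem_iota.
move=> kn; exists ((k, p), c); split=> //; last by case: c.
by apply: allpairs_f; [rewrite mem_iota | case: p].
Qed.

Lemma card_tosses_before (n : nat) : #|` tosses_before n| = (4 * n)%N.
Proof.
rewrite card_fseq undup_id; first by rewrite !size_allpairs size_iota -mulnA mulnC.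
apply: allpairs_uniq => //; last by move=> [? ?] [? ?] _ _.
by apply: allpairs_uniq => //; [exact: iota_uniq | move=> [? ?] [? ?] _ _].
Qed.

Lemma coin_preimage (i : toss) (b : bool) : P (coin i @^-1` [set b]) = (2^-1)%:E.
Proof.
have := coin_fair i; rewrite /fair_coin; case: b => // P1.
have -> : coin i @^-1` [set false] = ~` (coin i @^-1` [set true]).
  by apply/seteqP; split=> x /=; case: (coin i x).
rewrite probability_setC; last by rewrite -[X in measurable X]setTI; exact: measurable_funPT.
by rewrite P1 -EFinB; congr EFin; field.
Qed.

(** The default of [nth] is never read: only rounds before [size w] are queried. *)
Definition prescribed (w : seq outcome) (i : toss) : bool :=
  toss_value (nth ((false, false), (false, false)) w i.1.1) i.1.2 i.2.

(** This is the intersection form over a finite set of tosses to which mutual independence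
    applies. *)
Lemma cylinderE (w : seq outcome) :
  cylinder w =
  \bigcap_(i in [set` tosses_before (size w)]) coin i @^-1` [set prescribed w i].
Proof.
apply/seteqP; split=> [x /= wx [[k p] c] /=|x /= xw].
  rewrite mem_tosses_before /prescribed /= -wx size_mkseq => kw.
  by rewrite nth_mkseq //; case: p; case: c.
apply: (@eq_from_nth _ ((false, false), (false, false))); rewrite size_mkseq // => k kw.
have coinE p c : coin (k, p, c) x = toss_value (nth ((false, false), (false, false)) w k) p c.
  by rewrite [LHS](xw (k, p, c)) //= mem_tosses_before.
rewrite nth_mkseq // /outcome_of /tosses_at !coinE /toss_value.
by case: (nth _ _ _) => -[? ?] [? ?].
Qed.

Lemma measurable_cylinder (w : seq outcome) : measurable (cylinder w).
Proof.
rewrite cylinderE; apply: fin_bigcap_measurable => [|i _]; first exact: finite_fset.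
by rewrite -[X in measurable X]setTI; exact: measurable_funPT.
Qed.

Lemma cylinder_prob (w : seq outcome) : P (cylinder w) = (16^-1 ^+ size w)%:E.
Proof.
rewrite cylinderE coin_indep //.
under eq_bigr do rewrite coin_preimage.
rewrite prodEFin big_const_seq count_predT.
have -> : size (tosses_before (size w)) = (4 * size w)%N.
  exact: card_tosses_before.
(* Four tosses per round give the factor [2^-1 ^+ 4 = 16^-1]. *)
congr EFin; rewrite iter_mulr_1 exprM; congr (_ ^+ _); by field.
Qed.

(** * Tie probabilities as limits, and their recurrence *)

Section Run.
Variables (d1 d2 : nat).

(* The first of the [n] rounds is the one split off here, whereas [game_state]
   splits off the last one; [cylinder_tie_prob] reconciles the two. *)
Fixpoint tie_within (n : nat) (s : nat * nat) : R :=
  if n is n'.+1 then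
    16^-1 * \sum_(o : outcome) tie_within n' (play_round d1 d2 s o)
  else (s == (0, 0)%N)%:R.

Definition tie_event (s : nat * nat) (n : nat) : set T :=
  [set x | game_state d1 d2 s.1 s.2 (tosses_at x) n = (0, 0)%N].

Lemma cylinder_rcons (w : seq outcome) :
  cylinder w = \bigcup_(o in [set: outcome]) cylinder (rcons w o).
Proof.
rewrite /cylinder; apply/seteqP; split=> x /=.
  by move=> wx; exists (outcome_of (tosses_at x) (size w)) => //=; rewrite size_rcons mkseqS wx.
by case=> o _ /=; rewrite size_rcons mkseqS => /rcons_inj[].
Qed.

Lemma cylinder_tie (s : nat * nat) (w : seq outcome) :
  cylinder w `&` tie_event s (size w) =
  if foldl (play_round d1 d2) s w == (0, 0)%N then cylinder w else set0.
Proof.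
apply/seteqP; split=> x /=.
  by move=> [wx]; rewrite /tie_event /= game_stateE -surjective_pairing wx => ->; rewrite eqxx.
case: eqP => // sw wx; split=> //.
by rewrite /tie_event /= game_stateE -surjective_pairing wx.
Qed.

(** Induction on the number [n] of rounds still to come, for all prefixes [w]: the cylinder splits
    by the next outcome, and the prefix enters only through its probability and the state it leads
    to. *)
Lemma cylinder_tie_prob (n : nat) (s : nat * nat) (w : seq outcome) :
  measurable (cylinder w `&` tie_event s (size w + n)) /\
  P (cylinder w `&` tie_event s (size w + n)) =
    (16^-1 ^+ size w * tie_within n (foldl (play_round d1 d2) s w))%:E.
Proof.
elim: n w => [|n IHn] w.
  rewrite addn0 cylinder_tie /=; case: eqP => _.
    by rewrite cylinder_prob mulr1; split=> //; exact: measurable_cylinder.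
  by rewrite measure0 mulr0.
have -> : cylinder w `&` tie_event s (size w + n.+1) =
  \bigcup_(o in [set: outcome]) (cylinder (rcons w o) `&` tie_event s (size (rcons w o) + n)).
  rewrite {1}cylinder_rcons setI_bigcupl; apply: eq_bigcupr => o _.
  by rewrite size_rcons addSnnS.
have mF o : measurable (cylinder (rcons w o) `&` tie_event s (size (rcons w o) + n)).
  by have [] := IHn (rcons w o).
split.
  apply: fin_bigcup_measurable => [|o _]; [exact: finite_finset|exact: mF].
rewrite measure_fin_bigcup //; [|exact: finite_finset|]; last first.
  (* The pieces are disjoint because a point determines its outcome in round [size w]. *)
  move=> o o' _ _ [x [[+ _] [+ _]]]; rewrite /cylinder /= !size_rcons !mkseqS.
  by move=> /rcons_inj[_ <-] /rcons_inj[_ <-].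
transitivity (\sum_(o \in [set: outcome]) (16^-1 ^+ size (rcons w o) *
    tie_within n (foldl (play_round d1 d2) s (rcons w o)))%:E)%E.
  by apply: eq_fsbigr => o _; have [] := IHn (rcons w o).
have -> : [set: outcome] = [set` enum outcome].
  by apply/seteqP; split=> o //= _; rewrite mem_enum.
rewrite -fsbig_seq ?enum_uniq // big_enum sumEFin /= mulrA -exprSr mulr_sumr.
by congr EFin; apply: eq_bigr => o _; rewrite size_rcons foldl_rcons.
Qed.

Lemma tie_within_prob (s : nat * nat) (n : nat) :
  measurable (tie_event s n) /\ P (tie_event s n) = (tie_within n s)%:E.
Proof.
have := cylinder_tie_prob n s [::]; rewrite add0n expr0 mul1r.
have -> : cylinder [::] = setT by apply/seteqP; split.
by rewrite setTI.
Qed.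

Definition tie_prob (s : nat * nat) : R :=
  fine (tie_probability coin d1 d2 s.1 s.2).

(** The state [(0, 0)] is frozen once reached. *)
Lemma tie_event_nondecreasing (s : nat * nat) : nondecreasing_seq (tie_event s).
Proof.
apply/nondecreasing_seqP => n; rewrite subsetEset => x.
by rewrite /tie_event /= => ->.
Qed.

Lemma tie_eventE (s : nat * nat) :
  [set x | ends_in_tie d1 d2 s.1 s.2 (tosses_at x)] = \bigcup_n tie_event s n.
Proof. by apply/seteqP; split=> x /= [n]; exists n. Qed.

(** Continuity of [P] from below along the increasing events [tie_event s n]. *)
Lemma tie_within_cvg (s : nat * nat) :
  (fun n => tie_within n s) @ \oo --> tie_prob s.
Proof.
suff : (fun n => (tie_within n s)%:E) @ \oo --> (tie_prob s)%:E.
  by move/fine_cvgP => [].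
have -> : (fun n => (tie_within n s)%:E) = P \o tie_event s.
  by apply/funext => n /=; rewrite (tie_within_prob s n).2.
rewrite /tie_prob /tie_probability tie_eventE.
have mU : measurable (\bigcup_n tie_event s n).
  by apply: bigcup_measurable => n _; exact: (tie_within_prob s n).1.
rewrite fineK ?fin_num_measure //.
apply: nondecreasing_cvg_mu => //; last exact: tie_event_nondecreasing.
by move=> n; exact: (tie_within_prob s n).1.
Qed.

Lemma tie_probabilityE (s : nat * nat) :
  tie_probability coin d1 d2 s.1 s.2 = (tie_prob s)%:E.
Proof.
rewrite /tie_prob fineK // /tie_probability tie_eventE fin_num_measure //.
by apply: bigcup_measurable => n _; exact: (tie_within_prob s n).1.
Qed.

(** First-round conditioning is obtained by letting [n] tend to infinity in the recursion defining
    [tie_within]; both sides are limits of the same shifted sequence. *)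
Lemma tie_prob_rec (s : nat * nat) :
  tie_prob s = 16^-1 * \sum_(o : outcome) tie_prob (play_round d1 d2 s o).
Proof.
have cS : (fun n => tie_within n.+1 s) @ \oo --> tie_prob s.
  by rewrite (cvg_shiftS (tie_within^~ s)); exact: tie_within_cvg.
apply: (cvg_unique _ cS) => //=.
apply: cvgMl_tmp; apply: cvg_big => [|o _]; [exact: add_continuous|exact: tie_within_cvg].
Qed.

Lemma tie_prob_over (s : nat * nat) : (s.1 == 0)%N || (s.2 == 0)%N ->
  tie_prob s = (s == (0, 0)%N)%:R.
Proof.
move=> s0; have c : tie_within^~ s @ \oo --> ((s == (0, 0)%N)%:R : R).
  have -> : tie_within^~ s = cst (s == (0, 0)%N)%:R; last exact: cvg_cst.
  apply/funext => n /=; elim: n => //= n IHn.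
  under eq_bigr do rewrite /play_round s0 IHn.
  by rewrite sumr_const !card_prod card_bool -[X in _ * X]mulr_natl mulrA mulVf ?mul1r // pnatr_eq0.
exact: (cvg_unique _ (@tie_within_cvg s) c).
Qed.
End Run.
End Probability.

(** * Comparison of the two recurrences *)

(** The four results of two coins yield 0 and the three entries of [round_amounts], one each; hence
    multiplicities count when amounts coincide. *)
Lemma sum_eaten (V : nmodType) (d1 d2 : nat) (f : nat -> V) :
  \sum_(b : bool * bool) f (eaten d1 d2 b) =
  f 0%N + \sum_(E <- round_amounts d1 d2) f E.
Proof.
rewrite -(pair_bigA _ (fun b1 b2 => f (eaten d1 d2 (b1, b2)))) /= !big_bool /=.
rewrite !big_cons big_nil addr0 /eaten /= !addn0 !add0n.
(* The Boolean sum lists the amounts in the order [d1 + d2], [d1], [d2], [0]. *)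
by rewrite (AC (2*2) (4*(2*(3*1)))).
Qed.

Lemma round_amounts_gt0 (d1 d2 E : nat) : (0 < d1)%N -> (0 < d2)%N ->
  E \in round_amounts d1 d2 -> (0 < E)%N.
Proof. by move=> ? ?; rewrite !inE => /or3P[] /eqP ->; lia. Qed.

Section Combine.
Variables (R : realType) (d : measure_display) (T : measurableType d).
Variables (P : probability T R) (coin : toss -> {RV P >-> bool}).
Hypotheses (coin_fair : forall i : toss, fair_coin (coin i)).
Hypotheses (coin_indep : mutually_independent coin).
Variables (d1 d2 M : nat).
Hypotheses (d1_gt0 : (0 < d1)%N) (d2_gt0 : (0 < d2)%N).

Let u : R := 15^-1.
Let p (a b : nat) : R := tie_prob coin d1 d2 (a, b).

(** Of the 16 outcomes, the one with four tails leaves the state unchanged; its term [p a b] moves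
    to the left. *)
Lemma tie_prob_playing (a b : nat) : (0 < a)%N -> (0 < b)%N ->
  15 * p a b =
    \sum_(E <- round_amounts d1 d2) p (a - E) b +
    \sum_(E <- round_amounts d1 d2) p a (b - E) +
    \sum_(E <- round_amounts d1 d2) \sum_(E' <- round_amounts d1 d2) p (a - E) (b - E').
Proof.
move=> a0 b0.
have : 16 * p a b = \sum_(x : bool * bool) \sum_(y : bool * bool)
    p (a - eaten d1 d2 x) (b - eaten d1 d2 y).
  rewrite {1}/p tie_prob_rec // mulrA divff ?mul1r ?pnatr_eq0 // pair_bigA.
  apply: eq_bigr => o _; rewrite /play_round /=.
  by rewrite !gtn_eqF.
rewrite (sum_eaten d1 d2 (fun E => \sum_y p (a - E) (b - eaten d1 d2 y))).
rewrite (sum_eaten d1 d2 (fun E => p (a - 0) (b - E))) !subn0.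
under [X in _ = _ + X -> _]eq_bigr => E _.
  rewrite (sum_eaten d1 d2 (fun E' => p (a - E) (b - E'))) subn0; over.
rewrite big_split /= => p16.
have -> : 15 * p a b = 16 * p a b - p a b by ring.
rewrite p16; ring.
Qed.

(** Strong induction on [a + b]. The indicator corrects the origin, where the tie is certain but
    [tie_walks] vanishes; through the recurrence it generates the source term
    [last_round a * last_round b]. *)
Lemma tie_prob_walks (a b : nat) : (a < M)%N -> (b < M)%N ->
  p a b = 15^-1 * tie_walks d1 d2 M u a b + ((a, b) == (0, 0)%N)%:R.
Proof.
have [n] := ubnP (a + b); elim: n a b => // n IHn a b abn aM bM.
have [->|a0] := posnP a.
  by rewrite tie_walks0n mulr0 add0r [p _ _]tie_prob_over.
have [->|b0] := posnP b.
  by rewrite tie_walksn0 mulr0 add0r [p _ _]tie_prob_over ?orbT.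
rewrite xpair_eqE (gtn_eqF a0) addr0.
apply: (@mulfI _ 15); first by rewrite pnatr_eq0.
rewrite tie_prob_playing // mulrA divff ?pnatr_eq0 // mul1r tie_walks_rec //.
have E0 := @round_amounts_gt0 d1 d2 _ d1_gt0 d2_gt0.
set c := _ * last_round _ _ _ b.
rewrite [RHS]addrC !mulrDr !mulr_sumr -!addrA; congr (_ + (_ + _)).
(* When only one player eats, the other keeps a positive amount, so the indicator is zero. *)
- apply: eq_big_seq => E /E0 E_gt0; rewrite IHn; try lia.
  by rewrite xpair_eqE (gtn_eqF b0) andbF addr0.
- apply: eq_big_seq => E /E0 E_gt0; rewrite IHn; try lia.
  by rewrite xpair_eqE (gtn_eqF a0) addr0.
(* With truncated subtraction, [(a - E, b - E')] is [(0, 0)] exactly when [a <= E] and [b <= E'], so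
   the indicators add up to [c]. *)
- rewrite /c /last_round mulr_suml -big_split; apply: eq_big_seq => E /E0 E_gt0 /=.
  rewrite !mulr_sumr -big_split; apply: eq_big_seq => E' /E0 E'_gt0 /=.
  rewrite IHn; try lia.
  by rewrite xpair_eqE !subn_eq0 a0 b0 -mulnb natrM.
Qed.
End Combine.

Theorem theorem2p6 (R : realType) (d : measure_display)
    (T : measurableType d) (P : probability T R)
    (coin : toss -> {RV P >-> bool})
    (coin_fair : forall i : toss, fair_coin (coin i))
    (coin_indep : mutually_independent coin)
    (d1 d2 I1 I2 : nat)
    (d1_gt0 : (0 < d1)%N) (d2_gt0 : (0 < d2)%N)
    (I1_gt0 : (0 < I1)%N) (I2_gt0 : (0 < I2)%N) :
  tie_probability coin d1 d2 I1 I2 =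
  (15^-1 *
   \sum_(D <- [seq (D1, D2) | D1 <- round_amounts d1 d2,
                              D2 <- round_amounts d1 d2])
     \sum_(x \in step_counts d1 d2 I1 D.1)
       \sum_(y \in step_counts d1 d2 I2 D.2)
         let: (r, s, t) := x in
         let: (i, j, k) := y in
         trinomial R r s t * trinomial R i j k *
         delannoy (r + s + t) (i + j + k) (15^-1 : R))%:E.
Proof.
have -> := tie_probabilityE coin_fair coin_indep d1 d2 (I1, I2).
(* [(I1 + I2).+1] serves as the common bound [M] for both players' counts. *)
have I1M : (I1 < (I1 + I2).+1)%N by lia.
have I2M : (I2 < (I1 + I2).+1)%N by lia.
rewrite (tie_prob_walks coin_fair coin_indep d1_gt0 d2_gt0 I1M I2M).
by rewrite xpair_eqE (gtn_eqF I1_gt0) addr0 (tie_walksE d1_gt0 d2_gt0 _ (ltnW I1M) (ltnW I2M)).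
Qed.
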